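(* Suppose that the function $\widetilde F:\mathbb{R}^n\times\mathbb{R}^p\to(-\infty,\infty]$, $\widetilde F(x,u)=\Psi^*(-u)+\langle u,|Y^Tx|\rangle+\delta_{\mathcal M}(x)$, is a KL function. Then every sequence $\{x^k\}$ generated by the algorithm $\mathsf{ManPPA}_{\mathsf{rw}}$ converges to a stationary point of the problem $\min\{f(x):x\in\mathcal M\}$.
   Context: Setting. $Y\in\mathbb{R}^{n\times p}$; $\phi:\mathbb{R}_+\to\mathbb{R}_+$ is a continuous concave function with $\phi(0)=0$, differentiable on $(0,\infty)$, such that the limit $\ell:=\lim_{s\downarrow0}\phi'(s)$ exists (in $\mathbb{R}$). $\phi_+'(s)=\lim_{h\downarrow0}\frac{\phi(s+h)-\phi(s)}{h}$ is the right derivative, and $\Phi_+'(y)=(\phi_+'(y_1),\dots,\phi_+'(y_p))$ for $y\in\mathbb{R}^p_+$. $|y|$ is the vector of entrywise absolute values. $f(x)=\sum_{i=1}^p\phi(|[Y^Tx]_i|)$, $\mathcal M=\{u\in\mathbb{R}^n:\|u\|=1\}$ (Euclidean norm), $\delta_{\mathcal M}$ is the indicator function of $\mathcal M$ ($0$ on $\mathcal M$, $+\infty$ elsewhere), $F=f+\delta_{\mathcal M}$. $L_f:=\ell\sqrt p\,\|Y\|_2$, with $\|\cdot\|_2$ the operator norm. The function $\Psi$. $\psi:\mathbb{R}\to\mathbb{R}$ is the convex function $\psi(s)=-\phi(s)$ for $s\ge0$ and $\psi(s)=s^2-\ell s$ for $s<0$; $\Psi(y)=\sum_{i=1}^p\psi(y_i)$,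 and $\Psi^*(w)=\sum_{i=1}^p\psi^*(w_i)$ with $\psi^*(w)=\sup_s\{ws-\psi(s)\}$ the Fenchel conjugate. Algorithm $\mathsf{ManPPA}_{\mathsf{rw}}$. Choose $x^0\in\mathcal M$ and $t\in(0,2/L_f)$. For $k=0,1,2,\dots$: set $u^k=\Phi_+'(|Y^Tx^k|)$; let $d^k$ be the (unique) minimizer of $d\mapsto\sum_{i=1}^p u_i^k|[Y^T(x^k+d)]_i|+\frac1{2t}\|d\|^2$ over $\{d\in\mathbb{R}^n:\langle x^k,d\rangle=0\}$; set $x^{k+1}=\frac{x^k+d^k}{\|x^k+d^k\|}$. Subdifferentials. For a proper closed $h:\mathbb{R}^m\to(-\infty,\infty]$ and $\bar x\in\mathrm{dom}\,h$, the regular subdifferential is $\widehat\partial h(\bar x)=\{v:\liminf_{x\to\bar x,x\ne\bar x}\frac{h(x)-h(\bar x)-\langle v,x-\bar x\rangle}{\|x-\bar x\|}\ge0\}$ and the limiting subdifferential is $\partial h(\bar x)=\{v:\exists x^k\to\bar x,\ h(x^k)\to h(\bar x),\ v^k\in\widehat\partial h(x^k),\ v^k\to v\}$; both are empty outside $\mathrm{dom}\,h$; $\mathrm{dom}\,\partial h=\{x:\partial h(x)\ne\emptyset\}$. A point $x^*$ is a stationary point of $\min\{f(x):x\in\mathcal M\}$ if $0\in\partial F(x^* )$. KL property. A proper closed $h$ satisfies the KL property at $\hat x\in\mathrm{dom}\,\partial h$ if there are $a\in(0,\infty]$, a neighborhood $V$ of $\hat x$ and a continuous concave $\varphi:[0,a)\to[0,\infty)$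 with $\varphi(0)=0$, continuously differentiable on $(0,a)$ with $\varphi'>0$ there, such that $\varphi'(h(x)-h(\hat x))\,\mathrm{dist}(0,\partial h(x))\ge1$ for all $x\in V$ with $h(\hat x)<h(x)<h(\hat x)+a$ (where the distance to the empty set is $+\infty$). $h$ is a KL function if it satisfies the KL property at every point of $\mathrm{dom}\,\partial h$. *)

(* Defs.v *)
From HB Require Import structures.
From mathcomp Require Import all_boot all_order all_algebra.
From mathcomp Require Import all_classical all_reals all_analysis.

Set Implicit Arguments.
Unset Strict Implicit.
Unset Printing Implicit Defensive.

Import Order.TTheory GRing.Theory Num.Theory.
Import numFieldNormedType.Exports.

Local Open Scope classical_set_scope.
Local Open Scope ring_scope.

Section Euclidean.
Context {R : realType}.

Definition dot m (u v : 'cV[R]_m) : R := \sum_(i < m) u i 0 * v i 0.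

(* The library norm `|u| on matrices is the sup norm; it induces the same
   topology as [enorm] but must not be used for lengths. *)
Definition enorm m (u : 'cV[R]_m) : R := Num.sqrt (dot u u).

Definition opnorm n p (Y : 'M[R]_(n, p)) : R :=
  sup [set enorm (Y *m v) | v in [set v : 'cV[R]_p | enorm v <= 1]].

Definition absv m (y : 'cV[R]_m) : 'cV[R]_m := map_mx (fun s => `|s|) y.

Definition unit_sphere n : set 'cV[R]_n := [set x | enorm x = 1].

Definition indicator m (A : set 'cV[R]_m) (x : 'cV[R]_m) : \bar R :=
  if x \in A then 0%E else +oo%E.

Definition minimizer_on m (A : set 'cV[R]_m) (g : 'cV[R]_m -> R)
    (d : 'cV[R]_m) : Prop :=
  A d /\ forall e, A e -> g d <= g e.

End Euclidean.

Section VariationalAnalysis.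
Context {R : realType}.
Local Open Scope ereal_scope.

(* The notions below are meant for functions that never take the value -oo. *)

Definition dom m (h : 'cV[R]_m -> \bar R) : set 'cV[R]_m :=
  [set x | h x < +oo].

Definition regular_subdiff m (h : 'cV[R]_m -> \bar R) (xbar : 'cV[R]_m)
    : set 'cV[R]_m :=
  [set v | dom h xbar /\
    0 <= limf_einf
           (fun x : 'cV[R]_m =>
              (h x - h xbar - (dot v (x - xbar))%:E)
                * ((enorm (x - xbar))^-1)%:E)
           (xbar^')].

Definition limiting_subdiff m (h : 'cV[R]_m -> \bar R) (xbar : 'cV[R]_m)
    : set 'cV[R]_m :=
  [set v | dom h xbar /\
    exists x w : nat -> 'cV[R]_m,
      [/\ x @ \oo --> xbar,
          (h \o x) @ \oo --> h xbar,
          forall k, regular_subdiff h (x k) (w k)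
        & w @ \oo --> v]].

Definition dom_subdiff m (h : 'cV[R]_m -> \bar R) : set 'cV[R]_m :=
  [set x | limiting_subdiff h x !=set0].

(* [ereal_inf set0 = +oo], the intended distance to the empty set. *)
Definition dist0 m (A : set 'cV[R]_m) : \bar R :=
  ereal_inf [set (enorm v)%:E | v in A].

Definition concave_on (D : set R) (g : R -> R) : Prop :=
  @convex_function R R^o D (fun s => - g s)%R.

(* Desingularizing functions on [0, a[ are represented by total functions;
   only their values on [0, a[ matter. *)
Definition desingularizing (a : \bar R) (vphi : R -> R) : Prop :=
  let D := [set s : R | (0 <= s)%R /\ s%:E < a] in
  [/\ forall s, D s -> (0 <= vphi s)%R,
      {within D, continuous vphi},
      concave_on D vphi,
      vphi 0%R = 0%R
    & forall s : R, (0 < s)%R -> s%:E < a ->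
        [/\ derivable vphi s 1%R,
            {for s, continuous (derive1 vphi)}
          & (0 < derive1 vphi s)%R]].

Definition KL_at m (h : 'cV[R]_m -> \bar R) (xhat : 'cV[R]_m) : Prop :=
  exists (a : \bar R) (V : set 'cV[R]_m) (vphi : R -> R),
    [/\ 0 < a, nbhs xhat V, desingularizing a vphi
      & forall x, V x -> h xhat < h x -> h x < h xhat + a ->
          1 <= (derive1 vphi (fine (h x - h xhat)))%:E
                 * dist0 (limiting_subdiff h x)].

Definition KL_function m (h : 'cV[R]_m -> \bar R) : Prop :=
  forall xhat, dom_subdiff h xhat -> KL_at h xhat.

Definition fenchel_conj (g : R -> R) (w : R) : \bar R :=
  ereal_sup [set (w * s - g s)%:E | s in [set: R]].

End VariationalAnalysis.

Section ManPPA.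
Context {R : realType}.

(* A function [0, +oo[ -> [0, +oo[ is represented by a total phi : R -> R;
   only its values on [0, +oo[ matter. *)
Definition right_deriv (phi : R -> R) (s : R) : R :=
  lim ((phi (s + h) - phi s) / h @[h --> 0^'+]).

Definition right_deriv_vec (phi : R -> R) p (y : 'cV[R]_p) : 'cV[R]_p :=
  map_mx (right_deriv phi) y.

Definition objective (phi : R -> R) n p (Y : 'M[R]_(n, p)) (x : 'cV[R]_n)
    : R :=
  \sum_(i < p) phi `|(Y^T *m x) i 0|.

Definition objective_sphere (phi : R -> R) n p (Y : 'M[R]_(n, p))
    (x : 'cV[R]_n) : \bar R :=
  ((objective phi Y x)%:E + indicator (@unit_sphere R n) x)%E.

Definition stationary_point (phi : R -> R) n p (Y : 'M[R]_(n, p))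
    (x : 'cV[R]_n) : Prop :=
  limiting_subdiff (objective_sphere phi Y) x 0.

Definition Lf (ell : R) n p (Y : 'M[R]_(n, p)) : R :=
  ell * Num.sqrt p%:R * opnorm Y.

Definition psi (phi : R -> R) (ell s : R) : R :=
  if 0 <= s then - phi s else s ^+ 2 - ell * s.

Definition Psi_conj (phi : R -> R) (ell : R) p (w : 'cV[R]_p) : \bar R :=
  (\sum_(i < p) fenchel_conj (psi phi ell) (w i 0%R))%E.

Definition Ftilde (phi : R -> R) (ell : R) n p (Y : 'M[R]_(n, p))
    (x : 'cV[R]_n) (u : 'cV[R]_p) : \bar R :=
  (Psi_conj phi ell (- u)%R + (dot u (absv (Y^T *m x)))%:E
   + indicator (@unit_sphere R n) x)%E.

(* [Ftilde] as a function on R^(n+p), identified with R^n x R^p by stacking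
   the two column vectors. *)
Definition Ftilde_stacked (phi : R -> R) (ell : R) n p (Y : 'M[R]_(n, p))
    (z : 'cV[R]_(n + p)) : \bar R :=
  Ftilde phi ell Y (usubmx z) (dsubmx z).

Definition subproblem n p (Y : 'M[R]_(n, p)) (t : R) (x : 'cV[R]_n)
    (u : 'cV[R]_p) (d : 'cV[R]_n) : R :=
  \sum_(i < p) u i 0 * `|(Y^T *m (x + d)) i 0| + (2 * t)^-1 * enorm d ^+ 2.

(* The step size condition 0 < t < 2 / Lf is written as t * Lf < 2, so that
   2 / Lf is read as +oo when Lf = 0 (division by zero yields 0 here). *)
Definition manppa_rw_sequence (phi : R -> R) (ell : R) n p
    (Y : 'M[R]_(n, p)) (t : R) (x : nat -> 'cV[R]_n) : Prop :=
  [/\ unit_sphere (x 0%N),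
      0 < t,
      t * Lf ell Y < 2
    & forall k, exists d : 'cV[R]_n,
        minimizer_on [set e | dot (x k) e = 0]
          (subproblem Y t (x k) (right_deriv_vec phi (absv (Y^T *m x k)))) d
        /\ x k.+1 = (enorm (x k + d))^-1 *: (x k + d)].

End ManPPA.

(* Main.v *)
Require Import Defs.
From HB Require Import structures.
From mathcomp Require Import all_boot all_order all_algebra.
From mathcomp Require Import all_classical all_reals all_analysis.
From mathcomp Require Import ring lra.
Import Order.TTheory GRing.Theory Num.Theory.
Import numFieldNormedType.Exports.
Local Open Scope classical_set_scope.
Local Open Scope ring_scope.

Set Implicit Arguments.
Unset Strict Implicit.
Unset Printing Implicit Defensive.

(** The iterates are studied through the points [(x k.+1, u k)], where [u k] is
the vector of weights computed at [x k]. Three facts make them a descent sequence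
for the lifted function.

First, the lifted function majorises the objective on the sphere and touches it
at the weights of the base point, by the Fenchel-Young equality for [psi]
([Ftilde_ge], [Ftilde_weight]). Strong convexity of the subproblem lowers the
linearised objective by [t^-1 * enorm (d k) ^+ 2] over a step, and normalising
[x k + d k] lowers it further. Hence the lifted value at step [k] lies between
[objective (x k.+1)] and [objective (x k) - t^-1 * enorm (d k) ^+ 2]
([objective_le_lifted_value], [lifted_value_next_le]).

Second, the lifted function has at the [k]-th point a subgradient of norm at most
a constant times [enorm (d k)] ([lifted_subgrad_le]). No subdifferential calculus
is used: the optimality condition of the subproblem on the affine hyperplane
[dot x e = 1] is homogenised to a linear lower bound for the weighted sum of
absolute values ([prox_subgradP]), and inserting this bound in the Fenchel
minorant gives a quadratic lower estimate ([Ftilde_regular_subdiff]).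

Third, a cluster point [xs] of the iterates exists by compactness of the sphere.
The weights depend continuously on the base point because the derivative of a
differentiable concave function is continuous ([right_deriv_supergradient]), so
optimality passes to the limit ([critical_limit]). This gives at once the
subgradient [0] of the lifted function at [(xs, u)], where the
Kurdyka-Lojasiewicz inequality may therefore be applied, and the stationarity of
[xs] ([objective_sphere_regular_subdiff]).

The conclusion is the length argument of [KL_descent_cvg]: descent, the
subgradient bound and the Kurdyka-Lojasiewicz inequality make the sum of the
length travelled, twice the current step and the desingularised value gap
nonincreasing, so iterates that come close to [xs] stay close. Proximity of
[x k] and [x k.+1] to [xs] also forces [u k] close to [u], so it suffices to
control the iterates and not the weights. *)

(** * Euclidean geometry of column vectors *)

Section EuclideanLemmas.
Context {R : realType} {m : nat}.
Implicit Types (u v w : 'cV[R]_m) (a : R).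

Lemma dotC u v : dot u v = dot v u.
Proof. by apply: eq_bigr => i _; rewrite mulrC. Qed.

Lemma dotDl u v w : dot (u + v) w = dot u w + dot v w.
Proof. by rewrite -big_split; apply: eq_bigr => i _; rewrite mxE mulrDl. Qed.

Lemma dotZl a u v : dot (a *: u) v = a * dot u v.
Proof. by rewrite /dot mulr_sumr; apply: eq_bigr => i _; rewrite mxE mulrA. Qed.

Lemma dotNl u v : dot (- u) v = - dot u v.
Proof. by rewrite -scaleN1r dotZl mulN1r. Qed.

Lemma dotBl u v w : dot (u - v) w = dot u w - dot v w.
Proof. by rewrite dotDl dotNl. Qed.

Lemma dotDr u v w : dot u (v + w) = dot u v + dot u w.
Proof. by rewrite dotC dotDl !(dotC u). Qed.

Lemma dotZr a u v : dot u (a *: v) = a * dot u v.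
Proof. by rewrite dotC dotZl dotC. Qed.

Lemma dotNr u v : dot u (- v) = - dot u v.
Proof. by rewrite dotC dotNl dotC. Qed.

Lemma dotBr u v w : dot u (v - w) = dot u v - dot u w.
Proof. by rewrite dotDr dotNr. Qed.

Lemma dot0l v : dot 0 v = 0.
Proof. by rewrite -(scale0r v) dotZl mul0r. Qed.

Lemma dot_ge0 u : 0 <= dot u u.
Proof. by apply: sumr_ge0 => i _; rewrite -expr2 sqr_ge0. Qed.

Lemma enorm_ge0 u : 0 <= enorm u.
Proof. exact: sqrtr_ge0. Qed.

Lemma enorm_sqr u : enorm u ^+ 2 = dot u u.
Proof. by rewrite sqr_sqrtr// dot_ge0. Qed.

Lemma enorm_sqrD u v :
  enorm (u + v) ^+ 2 = enorm u ^+ 2 + 2 * dot u v + enorm v ^+ 2.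
Proof. rewrite !enorm_sqr dotDl !dotDr (dotC v u); ring. Qed.

Lemma enorm_sqrB u v :
  enorm (u - v) ^+ 2 = enorm u ^+ 2 - 2 * dot u v + enorm v ^+ 2.
Proof. rewrite !enorm_sqr dotBl !dotBr (dotC v u); ring. Qed.

Lemma enormZ a u : enorm (a *: u) = `|a| * enorm u.
Proof.
by rewrite /enorm dotZl dotZr mulrA -expr2 sqrtrM ?sqr_ge0// sqrtr_sqr.
Qed.

Lemma enormN u : enorm (- u) = enorm u.
Proof. by rewrite /enorm dotNl dotNr opprK. Qed.

Lemma enormBC u v : enorm (u - v) = enorm (v - u).
Proof. by rewrite -enormN opprB. Qed.

Lemma enorm0 : enorm (0 : 'cV[R]_m) = 0.
Proof. by rewrite /enorm dot0l sqrtr0. Qed.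

Lemma normr_coord_le u i : `|u i 0| <= enorm u.
Proof.
rewrite -sqrtr_sqr ler_sqrt ?dot_ge0// /dot (bigD1 i)//= -expr2 lerDl.
by apply: sumr_ge0 => j _; rewrite -expr2 sqr_ge0.
Qed.

Lemma enorm_eq0 u : enorm u = 0 -> u = 0.
Proof.
move=> u0; apply/colP => i; apply/eqP; rewrite mxE -normr_le0 -u0.
exact: normr_coord_le.
Qed.

Lemma dot_le_enorm u v : dot u v <= enorm u * enorm v.
Proof.
have [/enorm_eq0 ->|u0] := eqVneq (enorm u) 0.
  by rewrite dot0l enorm0 mul0r.
have [/enorm_eq0 ->|v0] := eqVneq (enorm v) 0.
  by rewrite dotC dot0l enorm0 mulr0.
have {}u0 : 0 < enorm u by rewrite lt0r u0 enorm_ge0.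
have {}v0 : 0 < enorm v by rewrite lt0r v0 enorm_ge0.
have := dot_ge0 (enorm v *: u - enorm u *: v).
rewrite -enorm_sqr enorm_sqrB !enormZ dotZl dotZr !ger0_norm ?enorm_ge0//.
move=> h; rewrite -subr_ge0 -(@pmulr_rge0 _ (2 * (enorm u * enorm v))).
  by apply: le_trans h _; rewrite le_eqVlt; apply/orP; left; apply/eqP; ring.
by rewrite !mulr_gt0.
Qed.

Lemma normr_dot_le u v : `|dot u v| <= enorm u * enorm v.
Proof.
rewrite ler_norml dot_le_enorm andbT lerNl -dotNl -(enormN u).
exact: dot_le_enorm.
Qed.

Lemma ler_enormD u v : enorm (u + v) <= enorm u + enorm v.
Proof.
rewrite -(@ler_pXn2r _ 2) ?nnegrE ?addr_ge0 ?enorm_ge0//.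
rewrite enorm_sqrD; have := dot_le_enorm u v; nra.
Qed.

Lemma enorm_le_sum u : enorm u <= \sum_(i < m) `|u i 0|.
Proof.
have s0 : 0 <= \sum_(i < m) `|u i 0| by apply: sumr_ge0.
rewrite -(@ler_pXn2r _ 2) ?nnegrE ?enorm_ge0//.
rewrite enorm_sqr expr2 mulr_suml; apply: ler_sum => i _.
rewrite (le_trans (ler_norm _))// normrM ler_wpM2l//.
by rewrite (bigD1 i)//= lerDl sumr_ge0.
Qed.

Lemma nbhs_enormP u (V : set 'cV[R]_m) :
  nbhs u V <-> exists2 e : R, 0 < e & forall v, enorm (v - u) < e -> V v.
Proof.
split=> [/nbhs_ballP [e /= e0 eV]|[e e0 eV]].
  exists e => // v vu; apply: eV; split => // i j; rewrite (ord1 j).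
  rewrite -ball_normE /ball_/= distrC (le_lt_trans _ vu)//.
  by have := normr_coord_le (v - u) i; rewrite !mxE.
apply/nbhs_ballP; exists (e / m.+1%:R); rewrite /= ?divr_gt0//.
move=> v [_ uv]; apply: eV; rewrite (le_lt_trans (enorm_le_sum _))//.
apply: (@le_lt_trans _ _ (\sum_(i < m) e / m.+1%:R)).
  apply: ler_sum => i _; have := uv i 0.
  by rewrite -ball_normE /ball_/= distrC !mxE => /ltW.
rewrite sumr_const card_ord -[_ *+ m]mulr_natr -mulrA gtr_pMr//.
by rewrite mulrC ltr_pdivrMr// mul1r ltr_nat.
Qed.

(** On the unit sphere the normal component of a displacement is of second
order, so multiples of the base point can be added to a subgradient for free. *)
Lemma dot_sphereB u v : enorm u = 1 -> enorm v = 1 ->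
  dot u (v - u) = - (enorm (v - u) ^+ 2 / 2).
Proof.
move=> u1 v1; rewrite enorm_sqrB dotBr -enorm_sqr u1 v1 (dotC v); lra.
Qed.

(** By Pythagoras [enorm (u + v) ^+ 2 = 1 + enorm v ^+ 2], so both claims are
inequalities about the single number [enorm (u + v)]. *)
Lemma enorm_retraction u v : enorm u = 1 -> dot u v = 0 ->
  1 <= enorm (u + v) /\
  enorm ((enorm (u + v))^-1 *: (u + v) - u) <= enorm v.
Proof.
move=> u1 uv0; have := enorm_sqrD u v; rewrite u1 uv0.
set r := enorm (u + v) => rE.
have r1 : 1 <= r.
  rewrite -(@ler_pXn2r _ 2) ?nnegrE ?enorm_ge0// rE; have := sqr_ge0 (enorm v); lra.
have r0 : 0 < r by lra.
split=> //; rewrite -(@ler_pXn2r _ 2) ?nnegrE ?enorm_ge0//.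
rewrite enorm_sqrB u1 enormZ dotZl dotDl -enorm_sqr u1 (dotC v) uv0.
rewrite ger0_norm ?invr_ge0 ?(ltW r0)// -/r mulVf ?gt_eqF//.
have -> : enorm v ^+ 2 = r ^+ 2 - 1 by rewrite rE; ring.
(* the difference of the two sides is (r - 1)^2 (r + 2) / r *)
rewrite -subr_ge0.
suff -> : r ^+ 2 - 1 - (1 ^+ 2 - 2 * (r^-1 * (1 ^+ 2 + 0)) + 1 ^+ 2)
    = (r - 1) ^+ 2 * (r + 2) / r.
  by rewrite divr_ge0 ?(ltW r0)// mulr_ge0 ?sqr_ge0//; lra.
by field; rewrite gt_eqF.
Qed.

End EuclideanLemmas.

Lemma enorm_usubmx_le {R : realType} n p (z : 'cV[R]_(n + p)) :
  enorm (usubmx z) <= enorm z.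
Proof.
rewrite ler_sqrt ?dot_ge0// /dot big_split_ord/=.
under eq_bigr do rewrite !mxE; rewrite lerDl.
by apply: sumr_ge0 => i _; rewrite -expr2 sqr_ge0.
Qed.

Lemma enorm_dsubmx_le {R : realType} n p (z : 'cV[R]_(n + p)) :
  enorm (dsubmx z) <= enorm z.
Proof.
rewrite ler_sqrt ?dot_ge0// /dot big_split_ord/= addrC.
under eq_bigr do rewrite !mxE; rewrite lerDl.
by apply: sumr_ge0 => i _; rewrite -expr2 sqr_ge0.
Qed.

Lemma dot_col_mx {R : realType} n p (a : 'cV[R]_n) (b : 'cV[R]_p) z :
  dot (col_mx a b) z = dot a (usubmx z) + dot b (dsubmx z).
Proof.
rewrite /dot big_split_ord/=; congr (_ + _); apply: eq_bigr => i _;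
  by rewrite ?col_mxEu ?col_mxEd !mxE.
Qed.

Lemma enorm_col_mx_le {R : realType} n p (a : 'cV[R]_n) (b : 'cV[R]_p) :
  enorm (col_mx a b) <= enorm a + enorm b.
Proof.
rewrite -(@ler_pXn2r _ 2) ?nnegrE ?addr_ge0 ?enorm_ge0//.
rewrite enorm_sqr dot_col_mx col_mxKu col_mxKd -!enorm_sqr.
have := enorm_ge0 a; have := enorm_ge0 b; nra.
Qed.

(** Bolzano-Weierstrass; recurrence at arbitrarily large indices stands for a
convergent subsequence. *)
Lemma sphere_cluster {R : realType} n (x : nat -> 'cV[R]_n) :
  (forall k, enorm (x k) = 1) ->
  exists2 xs, enorm xs = 1 & forall (e : R) N, 0 < e ->
    exists2 k, (N <= k)%N & enorm (x k - xs) < e.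
Proof.
move=> x1.
have cpt : compact [set v : 'rV[R]_n | forall i, `[(-1 : R), 1]%classic (v ord0 i)].
  by apply: (@rV_compact _ _ (fun=> `[(-1 : R), 1]%classic)) => i; exact: segment_compact.
have [|v [_ vcl]] := cpt ((fun k => (x k)^T) @ \oo) _.
  exists 0%N => // k _ i /=; rewrite in_itv/= -ler_norml mxE -(x1 k).
  exact: normr_coord_le.
have clus (e : R) N : 0 < e ->
    exists2 k, (N <= k)%N & enorm (x k - v^T) < e.
  move=> e0.
  have [||_ /= [[k /= Nk <-] xk]] := vcl [set (x k)^T | k in [set k | (N <= k)%N]]
   [set w | enorm (w^T - v^T) < e].
  - by exists N => // k /= Nk; exists k.
  - have /nbhs_ballP[d /= d0 dV] : nbhs v^T [set w | enorm (w - v^T) < e].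
      by apply/nbhs_enormP; exists e.
    apply/nbhs_ballP; exists d => //= w [_ vw]; apply: dV; split => // i j.
    by rewrite !mxE.
  by exists k => //; rewrite trmxK in xk.
exists v^T => //; apply/le_anti/andP; split.
  apply/ler_addgt0Pr => e e0; have [k _ ke] := clus e 0%N e0.
  rewrite -(subrKC (x k) v^T) (le_trans (ler_enormD _ _))// x1 lerD2l.
  by rewrite enormBC ltW.
apply/ler_addgt0Pr => e e0; have [k _ ke] := clus e 0%N e0.
rewrite -(x1 k) -{1}(subrKC v^T (x k)) (le_trans (ler_enormD _ _))// lerD2l.
exact: ltW.
Qed.

(** * Concave functions of one variable *)

Section ConcavePenalty.
Context {R : realType}.
Implicit Types (phi g : R -> R) (a s e : R).

Lemma concave_on_combination (D : set R) phi a s e :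
  concave_on D phi -> D a -> D s -> 0 <= e -> e <= 1 ->
  (1 - e) * phi a + e * phi s <= phi (a + e * (s - a)).
Proof.
move=> cphi Da Ds e0 e1.
have := cphi (Itv01 e0 e1) s a; rewrite !inE => /(_ Ds Da).
rewrite !convRE/= /unstable.onem => h.
have -> : a + e * (s - a) = e * s + (1 - e) * a by ring.
have {}h : - phi (e * s + (1 - e) * a) <= e * - phi s + (1 - e) * - phi a := h.
lra.
Qed.

Lemma derivable_first_order phi a e : derivable phi a 1 -> 0 < e ->
  exists2 d, 0 < d & forall h, `|h| < d ->
    `|phi (a + h) - phi a - h * derive1 phi a| <= e * `|h|.
Proof.
move=> /cvg_ex[l dphi] e0.
have lE : derive1 phi a = l by rewrite derive1E; exact: cvg_lim dphi.
move/cvgrPdist_le : dphi => /(_ _ e0) /nbhs_ballP[d /= d0 dP].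
exists d => // h hd; have [->|h0] := eqVneq h 0.
  by rewrite addr0 subrr mul0r subrr !normr0 mulr0.
have := dP h; rewrite -ball_normE /ball_/= sub0r normrN => /(_ hd h0).
rewrite /GRing.scale/= mulr1 (addrC h a) lE => {}dP.
have -> : phi (a + h) - phi a - h * l
    = - (h * (l - h^-1 * (phi (a + h) - phi a))).
  by rewrite mulrBr mulVKf//; ring.
by rewrite normrN normrM mulrC ler_wpM2r.
Qed.

(** A chord of a concave function stays below the tangent, because the slope of
the chord is at most the slope of every shorter chord from the same point. *)
Lemma concave_tangent (D : set R) phi a s :
  concave_on D phi -> D a -> D s -> derivable phi a 1 ->
  phi s <= phi a + derive1 phi a * (s - a).
Proof.
move=> cphi Da Ds dphi; rewrite -subr_le0 leNgt; apply/negP.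
set l : R := derive1 phi a => c0; set c : R := _ - _ in c0.
have sa : 0 < `|s - a|.
  rewrite normr_gt0 subr_eq0; apply/eqP => sa.
  by move: c0; rewrite /c sa; lra.
have e0 : 0 < c / (2 * `|s - a|) by rewrite divr_gt0// mulr_gt0.
have [d d0 dP] := derivable_first_order dphi e0.
pose th := Num.min 1 (d / (2 * `|s - a|)).
have th0 : 0 < th by rewrite lt_min ltr01 divr_gt0// mulr_gt0.
have th1 : th <= 1 by rewrite ge_min lexx.
have thd : `|th * (s - a)| < d.
  rewrite normrM (gtr0_norm th0) -ltr_pdivlMr//.
  rewrite (@le_lt_trans _ _ (d / (2 * `|s - a|)))//; first by rewrite ge_min lexx orbT.
  by rewrite ltr_pM2l// ltf_pV2 ?posrE ?mulr_gt0// ltr_pMl// ltr1n.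
have := dP _ thd; have := concave_on_combination cphi Da Ds (ltW th0) th1.
rewrite normrM (gtr0_norm th0) => h1 /ler_normlP[_ h2].
have cE : c / (2 * `|s - a|) * (th * `|s - a|) = th * (c / 2).
  by field; rewrite gt_eqF.
have : 0 < th * c by rewrite mulr_gt0.
rewrite cE in h2; rewrite -/l in h2; rewrite /c in h2 *; nra.
Qed.

(** A continuous bounded selection [g] of the superdifferential on the half-line;
the derivative of the penalty enters the convergence argument only through it. *)
Record supergradient phi g (ell : R) : Prop := Supergradient {
  supergradient_tangent : forall a s, 0 <= a -> 0 <= s ->
    phi s <= phi a + g a * (s - a);
  supergradient_ge0 : forall a, 0 <= a -> 0 <= g a;
  supergradient_le : forall a, 0 <= a -> g a <= ell;
  supergradient_continuous : forall a e, 0 <= a -> 0 < e ->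
    exists2 d, 0 < d & forall s, 0 <= s -> `|s - a| < d -> `|g s - g a| < e }.

Section RightDerivative.
Variables (phi : R -> R) (ell : R).
Hypotheses (phi_ge0 : forall s, 0 <= s -> 0 <= phi s)
  (phi_cont : {within [set s : R | 0 <= s], continuous phi})
  (phi_concave : concave_on [set s : R | 0 <= s] phi)
  (phi0 : phi 0 = 0)
  (phi_diff : forall s, 0 < s -> derivable phi s 1)
  (phi_ell : derive1 phi s @[s --> 0^'+] --> ell).

Let tangent_pos a s : 0 < a -> 0 <= s ->
  phi s <= phi a + derive1 phi a * (s - a).
Proof.
by move=> a0 s0; apply: (concave_tangent phi_concave) => //=; rewrite ?ltW//; exact: phi_diff.
Qed.

(** A negative slope would drive the function below [0] far to the right. *)
Let slope_ge0 a l : 0 <= a ->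
  (forall s, 0 <= s -> phi s <= phi a + l * (s - a)) -> 0 <= l.
Proof.
move=> a0 tangent; rewrite leNgt; apply/negP => l0.
(* the tangent line takes the value -1 at [a + q] *)
pose q := (phi a + 1) / - l.
have q0 : 0 <= q by rewrite divr_ge0 ?addr_ge0 ?oppr_ge0 ?(ltW l0) ?phi_ge0.
have qE : l * (a + q - a) = - (phi a + 1) by rewrite /q; field; rewrite lt_eqF.
have := tangent _ (addr_ge0 a0 q0); have := phi_ge0 (addr_ge0 a0 q0).
rewrite qE; lra.
Qed.

Let derive1_near0 e : 0 < e ->
  exists2 d, 0 < d & forall s, 0 < s -> s < d -> `|ell - derive1 phi s| < e.
Proof.
move=> e0; move/cvgrPdist_lt : phi_ell => /(_ _ e0) /nbhs_ballP[d /= d0 dP].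
exists d => // s s0 sd; apply: (dP s) => //.
by rewrite -ball_normE /ball_/= sub0r normrN gtr0_norm.
Qed.

Let phi_near0 e : 0 < e ->
  exists2 d, 0 < d & forall s, 0 < s -> s < d -> phi s < e.
Proof.
move=> e0; have : phi s @[s --> within [set s : R | 0 <= s] (nbhs (0 : R))] --> 0.
  rewrite -[X in _ --> X]phi0.
  by move/subspace_continuousP : phi_cont => /(_ 0 (lexx 0)).
move=> /cvgrPdist_lt /(_ _ e0) /nbhs_ballP[d /= d0 dP].
exists d => // s s0 sd; have := dP s.
rewrite -ball_normE /ball_/= !sub0r !normrN gtr0_norm// => /(_ sd (ltW s0)).
by move/(le_lt_trans (ler_norm _)).
Qed.

(** Limit of the tangents at points decreasing to [0]. *)
Let tangent_0 s : 0 <= s -> phi s <= ell * s.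
Proof.
rewrite le_eqVlt => /predU1P[<-|s0]; first by rewrite phi0 mulr0.
apply/ler_addgt0Pr => e e0.
have e1 : 0 < e / (2 * s) by rewrite divr_gt0// mulr_gt0.
have [d d0 dP] := derive1_near0 e1.
have [d' d'0 d'P] := phi_near0 (divr_gt0 e0 (ltr0Sn _ 1)).
pose a := Num.min (Num.min d d') s / 2.
have m0 : 0 < Num.min (Num.min d d') s by rewrite !lt_min d0 d'0 s0.
have [ad ad' as_] : [/\ a < d, a < d' & a < s].
  have : Num.min (Num.min d d') s <= d by rewrite !ge_min lexx.
  have : Num.min (Num.min d d') s <= d' by rewrite !ge_min lexx orbT.
  have : Num.min (Num.min d d') s <= s by rewrite !ge_min lexx orbT.
  by rewrite /a; split; lra.
have a0 : 0 < a by rewrite /a; lra.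
have g0 : 0 <= derive1 phi a.
  by apply: (slope_ge0 (ltW a0)) => r r0; exact: tangent_pos.
have := tangent_pos a0 (ltW s0); have := d'P _ a0 ad'; have := dP _ a0 ad.
move=> /ltr_normlP[h1 _] h2 h3.
have es : e / (2 * s) * s = e / 2 by field; rewrite gt_eqF.
have : derive1 phi a * (s - a) <= derive1 phi a * s.
  by rewrite ler_wpM2l//; lra.
have : derive1 phi a * s <= (ell + e / (2 * s)) * s.
  by rewrite ler_wpM2r ?ltW//; lra.
rewrite mulrDl es; lra.
Qed.

Lemma right_deriv_pos s : 0 < s -> right_deriv phi s = derive1 phi s.
Proof.
move=> s0; apply/cvg_lim => //; apply/cvgrPdist_le => e e0.
have [d d0 dP] := derivable_first_order (phi_diff s0) e0.
apply/nbhs_ballP; exists d => //= h.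
rewrite -ball_normE /ball_/= sub0r normrN => hd h0.
have := dP h hd; rewrite (gtr0_norm h0) -ler_pdivrMr//.
have -> : derive1 phi s - (phi (s + h) - phi s) / h
    = - (phi (s + h) - phi s - h * derive1 phi s) / h by field; rewrite gt_eqF.
by rewrite normrM normrN normfV (gtr0_norm h0).
Qed.

(** The chord from [0] to [h] has slope between that of the tangent at [h] and that
of the limiting tangent at [0], and both tend to [ell]. *)
Lemma right_deriv_0 : right_deriv phi 0 = ell.
Proof.
apply/cvg_lim => //; apply/cvgrPdist_le => e e0.
have [d d0 dP] := derive1_near0 e0.
apply/nbhs_ballP; exists d => //= h.
rewrite -ball_normE /ball_/= sub0r normrN => hd h0.
rewrite (gtr0_norm h0) in hd; rewrite add0r phi0 subr0.
have := tangent_0 (ltW h0); rewrite -ler_pdivrMr// => h1.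
have := tangent_pos h0 (lexx 0); rewrite phi0 sub0r mulrN subr_ge0 -ler_pdivlMr// => h2.
have /ltr_normlP[h3 h4] := dP h h0 hd.
by apply/ler_normlP; split; lra.
Qed.

(** Continuity at [0] is the hypothesis on [ell]. At interior points it comes from
concavity: near a point of differentiability the slopes are caught between those
of two short chords. *)
Lemma right_deriv_supergradient : supergradient phi (right_deriv phi) ell.
Proof.
have tangent a s : 0 <= a -> 0 <= s ->
    phi s <= phi a + right_deriv phi a * (s - a).
  rewrite le_eqVlt => /predU1P[<-|a0] s0.
    by rewrite right_deriv_0 phi0 add0r subr0 tangent_0.
  by rewrite right_deriv_pos// tangent_pos.
have g0 a : 0 <= a -> 0 <= right_deriv phi a.
  by move=> a0; apply: (slope_ge0 a0) => s; exact: tangent.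
split=> // [a|a e a0 e0].
  rewrite -right_deriv_0 le_eqVlt => /predU1P[<-//|a0].
  rewrite leNgt; apply/negP => ga.
  have := tangent 0 a (lexx 0) (ltW a0); have := tangent a 0 (ltW a0) (lexx 0).
  rewrite phi0; nra.
move: a0; rewrite le_eqVlt => /predU1P[<-|a0].
  have [d d0 dP] := derive1_near0 e0; exists d => // s.
  rewrite le_eqVlt => /predU1P[<- _|s0]; first by rewrite subrr normr0.
  rewrite subr0 (gtr0_norm s0) right_deriv_0 right_deriv_pos// distrC.
  exact: dP.
have e4 : 0 < e / 4 by lra.
have [d d0 dP] := derivable_first_order (phi_diff a0) e4.
pose h := Num.min d a / 2.
have m0 : 0 < Num.min d a by rewrite lt_min d0 a0.
have [h0 hd ha] : [/\ 0 < h, h < d & h < a].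
  have : Num.min d a <= d by rewrite ge_min lexx.
  have : Num.min d a <= a by rewrite ge_min lexx orbT.
  by rewrite /h; split; lra.
exists (h / 2); first lra.
move=> b b0 ba; rewrite (right_deriv_pos a0); set l : R := derive1 phi a in dP *.
(* the tangent at [b], tested at [a - h] and [a + h], is squeezed by two chords *)
have := tangent b (a - h) b0 ltac:(lra).
have := tangent b (a + h) b0 ltac:(lra).
have := dP (b - a) ltac:(lra); have := dP h; have := dP (- h).
rewrite normrN (gtr0_norm h0) subrKC => /(_ hd)/ler_normlP[A1 A2].
move=> /(_ hd)/ler_normlP[B1 B2] /ler_normlP[C1 C2] T1 T2.
have /ltr_normlP[ba1 ba2] := ba.
have C3 : e / 4 * `|b - a| <= e / 4 * (h / 2) by rewrite ler_pM2l// ltW.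
set gb := right_deriv phi b in T1 T2 *.
have U1 : (gb - l) * (b - (a - h)) <= e / 4 * (h / 2 + h).
  move: T2 A1 C2 C3; nra.
have U2 : (l - gb) * (a + h - b) <= e / 4 * (h / 2 + h).
  move: T1 B1 C1 C3; nra.
apply/ltr_normlP; split; rewrite ltNge; apply/negP => ge.
  have : e * (h / 2) <= (l - gb) * (a + h - b) by apply: ler_pM; lra.
  nra.
have : e * (h / 2) <= (gb - l) * (b - (a - h)) by apply: ler_pM; lra.
nra.
Qed.

End RightDerivative.

End ConcavePenalty.

(** * Weighted absolute values and the linearised subproblem *)

Section WeightedAbs.
Context {R : realType} {n p : nat}.
Variable Y : 'M[R]_(n, p).
Implicit Types (x e d w : 'cV[R]_n) (u a : 'cV[R]_p).

Definition wabs u e : R := \sum_(i < p) u i 0 * `|(Y^T *m e) i 0|.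

Definition absY_lip : R := \sum_(i < p) enorm (col i Y).

Lemma wabsE u e : wabs u e = dot u (absv (Y^T *m e)).
Proof. by apply: eq_bigr => i _; rewrite [absv _ _ _]mxE. Qed.

Lemma absv_ge0 m (y : 'cV[R]_m) i : 0 <= absv y i 0.
Proof. by rewrite mxE. Qed.

Lemma absY_lip_ge0 : 0 <= absY_lip.
Proof. by apply: sumr_ge0 => i _; exact: enorm_ge0. Qed.

Lemma enorm_absY_le x e :
  enorm (absv (Y^T *m x) - absv (Y^T *m e)) <= absY_lip * enorm (x - e).
Proof.
rewrite (le_trans (enorm_le_sum _))// mulr_suml; apply: ler_sum => i _.
rewrite !mxE -!/(fun_of_matrix _ _ _) (le_trans (ler_dist_dist _ _))//.
have -> : \sum_j Y^T i j * x j 0 - \sum_j Y^T i j * e j 0 = dot (col i Y) (x - e).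
  rewrite dotBr /dot; congr (_ - _); by apply: eq_bigr => j _; rewrite !mxE.
exact: normr_dot_le.
Qed.

Lemma enorm_absY_le0 e : enorm (absv (Y^T *m e)) <= absY_lip * enorm e.
Proof.
have := enorm_absY_le e 0; rewrite mulmx0 subr0.
have -> : absv 0 = 0 :> 'cV[R]_p by apply/colP => i; rewrite !mxE normr0.
by rewrite subr0.
Qed.

Lemma wabs_ge0 u e : (forall i, 0 <= u i 0) -> 0 <= wabs u e.
Proof. by move=> u0; apply: sumr_ge0 => i _; rewrite mulr_ge0. Qed.

Lemma wabsZ u e (c : R) : wabs u (c *: e) = `|c| * wabs u e.
Proof.
rewrite /wabs mulr_sumr; apply: eq_bigr => i _.
by rewrite -scalemxAr mxE normrM mulrCA.
Qed.

Lemma wabs_convex u e d (s : R) : (forall i, 0 <= u i 0) -> 0 <= s -> s <= 1 ->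
  wabs u (e + s *: (d - e)) <= (1 - s) * wabs u e + s * wabs u d.
Proof.
move=> u0 s0 s1; rewrite /wabs !mulr_sumr -big_split/=; apply: ler_sum => i _.
rewrite !(mulrCA _ (u i 0)) -mulrDr ler_wpM2l//.
have -> : Y^T *m (e + s *: (d - e)) = (1 - s) *: (Y^T *m e) + s *: (Y^T *m d).
  rewrite mulmxDr -scalemxAr mulmxBr scalerBr scalerBl scale1r.
  by rewrite addrCA addrC addrAC.
move: (Y^T *m e) (Y^T *m d) => y z; rewrite !mxE.
rewrite (le_trans (ler_normD _ _))// !normrM (ger0_norm s0).
by rewrite ger0_norm ?subr_ge0.
Qed.

Lemma wabs_lipl u a e : `|wabs u e - wabs a e| <= enorm (u - a) * (absY_lip * enorm e).
Proof.
rewrite !wabsE -dotBl (le_trans (normr_dot_le _ _))// ler_wpM2l ?enorm_ge0//.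
exact: enorm_absY_le0.
Qed.

Lemma wabs_lipr u x e : `|wabs u x - wabs u e| <= enorm u * (absY_lip * enorm (x - e)).
Proof.
rewrite !wabsE -dotBr (le_trans (normr_dot_le _ _))// ler_wpM2l ?enorm_ge0//.
exact: enorm_absY_le.
Qed.

Section Subproblem.
Variables (t : R) (x d : 'cV[R]_n) (u : 'cV[R]_p).
Hypotheses (t0 : 0 < t) (x1 : enorm x = 1) (u0 : forall i, 0 <= u i 0).
Hypothesis dmin : minimizer_on [set e | dot x e = 0] (subproblem Y t x u) d.

(** First-order optimality of [d], tested along the segment from [x + d] to a
point [e] of the tangent hyperplane at [x]. *)
Lemma subproblem_optimality e : dot x e = 1 ->
  wabs u (x + d) - t^-1 * dot d (e - (x + d)) <= wabs u e.
Proof.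
move=> xe; have [xd dle] := dmin; set q := e - (x + d).
have xq : dot x q = 0 by rewrite dotBr dotDr xe xd -enorm_sqr x1; lra.
rewrite -subr_ge0; set D := (X in 0 <= X).
suff H s : 0 < s -> s <= 1 -> 0 <= D + s * ((2 * t)^-1 * enorm q ^+ 2).
  rewrite leNgt; apply/negP => D0.
  pose B := (2 * t)^-1 * enorm q ^+ 2.
  have B0 : 0 <= B by rewrite mulr_ge0 ?sqr_ge0// invr_ge0 mulr_ge0 ?ltW.
  have B1 : 0 < B - D by lra.
  (* [s := - D / (B - D)] lies in ]0, 1] and makes [D + s * B] negative *)
  have := H (- D / (B - D)) (divr_gt0 _ B1); rewrite oppr_gt0 => /(_ D0).
  rewrite ler_pdivrMr// mul1r => /(_ ltac:(lra)); rewrite -/B.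
  have -> : D + - D / (B - D) * B = - (D ^+ 2 / (B - D)).
    by field; rewrite gt_eqF.
  rewrite oppr_ge0 leNgt => /negP; apply.
  by rewrite divr_gt0// lt0r sqr_ge0 expf_neq0// lt_eqF.
move=> s0 s1; have := dle (d + s *: q).
rewrite /= dotDr dotZr xd xq mulr0 addr0 => /(_ erefl).
rewrite /subproblem -!/(wabs _ _) addrA enorm_sqrD dotZr enormZ (gtr0_norm s0).
have := wabs_convex (x + d) e u0 (ltW s0) s1; rewrite -/q => h1 h2.
rewrite -(pmulr_rge0 _ s0).
have -> : s * (D + s * ((2 * t)^-1 * enorm q ^+ 2))
  = (1 - s) * wabs u (x + d) + s * wabs u e
    + (2 * t)^-1 * (enorm d ^+ 2 + 2 * (s * dot d q) + (s * enorm q) ^+ 2)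
    - (wabs u (x + d) + (2 * t)^-1 * enorm d ^+ 2).
  by rewrite /D; field; rewrite gt_eqF.
lra.
Qed.

Definition prox_mult : R := wabs u (x + d) + t^-1 * enorm d ^+ 2.

Lemma prox_mult_ge0 : 0 <= prox_mult.
Proof.
apply: addr_ge0; first exact: wabs_ge0.
by apply: mulr_ge0; rewrite ?sqr_ge0// invr_ge0 ltW.
Qed.

(** Optimality tested against the zero step: this is the decrease of the model,
and it bounds the multiplier by a quantity that does not involve [d]. *)
Lemma prox_mult_le : prox_mult <= wabs u x.
Proof.
have := @subproblem_optimality x; rewrite -enorm_sqr x1 expr1n => /(_ erefl).
by rewrite opprD addNKr dotNr -enorm_sqr mulrN opprK.
Qed.

Definition prox_subgrad : 'cV[R]_n := prox_mult *: x - t^-1 *: d.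

(** The optimality inequality, homogenised: it holds on the hyperplane
[dot x e = 1], and [wabs u] is positively homogeneous, so it extends to the
half-space [0 < dot x e]; [prox_mult] is the multiplier of the constraint. *)
Lemma prox_subgradP e : 0 < dot x e -> dot prox_subgrad e <= wabs u e.
Proof.
move=> xe; have xe1 : dot x ((dot x e)^-1 *: e) = 1.
  by rewrite dotZr mulVf// gt_eqF.
have := subproblem_optimality xe1; have [xd _] := dmin.
rewrite wabsZ dotBr dotZr (dotC d (x + d)) dotDl xd add0r -enorm_sqr.
rewrite gtr0_norm ?invr_gt0// [_^-1 * wabs _ _]mulrC ler_pdivlMr// => h.
rewrite dotBl !dotZl (le_trans _ h)// /prox_mult le_eqVlt; apply/orP; left.
by apply/eqP; field; rewrite !gt_eqF.
Qed.

Lemma prox_subgradE : dot prox_subgrad (x + d) = wabs u (x + d).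
Proof.
have [xd _] := dmin.
rewrite dotBl !dotZl !dotDr (dotC d x) xd -!enorm_sqr x1 /prox_mult; ring.
Qed.

End Subproblem.

End WeightedAbs.

(** * Subgradients of extended-valued functions *)

Section Subdifferential.
Context {R : realType} {m : nat}.
Implicit Types (h : 'cV[R]_m -> \bar R) (x v : 'cV[R]_m).

(** Only a minorant is asked for, so [h] may be infinite away from [x]; the
quotient in the definition is then bounded below by [- e]. *)
Lemma regular_subdiff_minorant h x v (r : R) :
  h x = r%:E ->
  (forall e, 0 < e -> exists2 d, 0 < d & forall y, enorm (y - x) < d ->
     ((r + dot v (y - x) - e * enorm (y - x))%:E <= h y)%E) ->
  regular_subdiff h x v.
Proof.
move=> hx minor; split; first by rewrite /dom/= hx ltry.
apply/lee_addgt0Pr => e e0.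
have [d d0 dP] := minor e e0.
rewrite limf_einfE -leeBlDr// sub0e.
pose V := [set y : 'cV[R]_m | enorm (y - x) < d /\ y != x].
apply: (@le_trans _ _ (ereal_inf ((fun y : 'cV[R]_m =>
     ((h y - h x - (dot v (y - x))%:E) * ((enorm (y - x))^-1)%:E)%E) @` V))).
  apply: le_ereal_inf_tmp => _ [y [yd yx] <-].
  have n0 : 0 < enorm (y - x).
    rewrite lt0r enorm_ge0 andbT; apply: contraNN yx => /eqP /enorm_eq0 /eqP.
    by rewrite subr_eq0.
  rewrite -EFinN lee_pdivlMr//.
  rewrite leeBrDr// hx leeBrDr// -!EFinD.
  by apply: le_trans (dP _ yd); rewrite lee_fin; lra.
apply: ereal_sup_ubound; exists V => //.
have : nbhs x [set y | enorm (y - x) < d] by apply/nbhs_enormP; exists d.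
by apply: filterS => y yd yx; split => //; exact/eqP.
Qed.

Lemma regular_limiting_subdiff h x v :
  regular_subdiff h x v -> limiting_subdiff h x v.
Proof.
move=> hv; split; first by case: hv.
by exists (fun=> x), (fun=> v); split => //; exact: cvg_cst.
Qed.

End Subdifferential.

(** * The lifted function *)

Definition weights {R : realType} {n p : nat} (g : R -> R) (Y : 'M[R]_(n, p)) x :=
  map_mx g (absv (Y^T *m x)).

Section Lifted.
Context {R : realType} {n p : nat}.
Variables (Y : 'M[R]_(n, p)) (phi g : R -> R) (ell : R).
Hypothesis sg : supergradient phi g ell.
Hypothesis phi0 : phi 0 = 0.
Implicit Types (x w : 'cV[R]_n) (u a s : 'cV[R]_p).

Local Notation weight := (weights g Y).

Definition penalty_sum a : R := \sum_(i < p) phi (a i 0).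

Lemma objectiveE x : objective phi Y x = penalty_sum (absv (Y^T *m x)).
Proof. by apply: eq_bigr => i _; rewrite [absv _ _ _]mxE. Qed.

Lemma penalty_sum_tangent a s :
  (forall i, 0 <= a i 0) -> (forall i, 0 <= s i 0) ->
  penalty_sum s <= penalty_sum a + dot (map_mx g a) (s - a).
Proof.
move=> a0 s0; rewrite /penalty_sum /dot -big_split/=; apply: ler_sum => i _.
by rewrite !mxE (supergradient_tangent sg).
Qed.

Lemma weight_ge0 x i : 0 <= weight x i 0.
Proof. by rewrite [weight x i 0]mxE (supergradient_ge0 sg)// absv_ge0. Qed.

Lemma enorm_weight_le x : enorm (weight x) <= p%:R * ell.
Proof.
rewrite (le_trans (enorm_le_sum _))//.
rewrite (_ : _ * _ = \sum_(i < p) ell); last first.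
  by rewrite sumr_const card_ord mulr_natl.
apply: ler_sum => i _; rewrite ger0_norm ?weight_ge0// [weight x i 0]mxE.
by rewrite (supergradient_le sg)// absv_ge0.
Qed.

Lemma weight_continuous x e : 0 < e ->
  exists2 d, 0 < d & forall y, enorm (y - x) < d -> enorm (weight y - weight x) < e.
Proof.
move=> e0; apply/nbhs_enormP.
suff : \forall y \near x, forall i : 'I_p,
    `|weight y i 0 - weight x i 0| < e / p.+1%:R.
  apply: filterS => y yP; rewrite (le_lt_trans (enorm_le_sum _))//.
  apply: (@le_lt_trans _ _ (\sum_(i < p) e / p.+1%:R)).
    by apply: ler_sum => i _; rewrite mxE [X in _ + X]mxE ltW.
  rewrite sumr_const card_ord -[_ *+ p]mulr_natr -mulrA gtr_pMr//.
  by rewrite mulrC ltr_pdivrMr// mul1r ltr_nat.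
apply: (@filter_forall _ _ (fun (i : 'I_p) (y : 'cV[R]_n) =>
  `|weight y i 0 - weight x i 0| < e / p.+1%:R) (nbhs x) _) => i.
apply/nbhs_enormP.
have e1 : 0 < e / p.+1%:R by rewrite divr_gt0.
have [d d0 dP] := supergradient_continuous sg (absv_ge0 (Y^T *m x) i) e1.
have c0 := @absY_lip_ge0 R n p Y.
exists (d / (absY_lip Y + 1)); first by rewrite divr_gt0//; lra.
move=> y; rewrite ltr_pdivlMr; last lra.
move=> yx; rewrite [weight y i 0]mxE [weight x i 0]mxE.
apply: dP; first exact: absv_ge0.
have := normr_coord_le (absv (Y^T *m y) - absv (Y^T *m x)) i.
rewrite mxE [X in _ + X]mxE => /le_lt_trans; apply.
rewrite (le_lt_trans (enorm_absY_le _ _ _))//.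
have := enorm_ge0 (y - x); nra.
Qed.

Lemma objective_lip x y :
  objective phi Y x <= objective phi Y y + p%:R * ell * (absY_lip Y * enorm (x - y)).
Proof.
rewrite !objectiveE (le_trans (penalty_sum_tangent (absv_ge0 (Y^T *m y)) (absv_ge0 _)))//.
rewrite lerD2l (le_trans (dot_le_enorm _ _))// ler_pM ?enorm_ge0//.
  exact: enorm_weight_le.
exact: enorm_absY_le.
Qed.

Lemma fenchel_conj_psi_ge (u a : R) : 0 <= a ->
  ((phi a - u * a)%:E <= fenchel_conj (psi phi ell) (- u))%E.
Proof.
move=> a0; apply: ereal_sup_ubound; exists a => //.
by rewrite /psi a0; congr (_%:E); ring.
Qed.

(** Equality in Fenchel-Young: [- g a] is a subgradient of [psi] at [a], on the
quadratic branch because [g a <= ell]. *)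
Lemma fenchel_conj_psi_eq (a : R) : 0 <= a ->
  fenchel_conj (psi phi ell) (- g a) = (phi a - g a * a)%:E.
Proof.
move=> a0; apply/le_anti/andP; split; last exact: fenchel_conj_psi_ge.
apply: ge_ereal_sup => _ [s _ <-]; rewrite lee_fin /psi.
have := supergradient_tangent sg a0 (lexx 0); rewrite phi0 => h0.
have gl := supergradient_le sg a0.
case: (lerP 0 s) => [s0|s0].
  have := supergradient_tangent sg a0 s0; lra.
have := sqr_ge0 s; nra.
Qed.

(** The conjugates are bounded below by their value along the single slope [a];
this is an equality for [u = map_mx g a], so the right-hand side serves as an
explicit minorant from which subgradients are read off. *)
Lemma Ftilde_ge x u a : enorm x = 1 -> (forall i, 0 <= a i 0) ->
  ((penalty_sum a + dot u (absv (Y^T *m x) - a))%:E <= Ftilde phi ell Y x u)%E.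
Proof.
move=> x1 a0; rewrite /Ftilde /indicator mem_set// adde0 dotBr.
have -> : penalty_sum a + (dot u (absv (Y^T *m x)) - dot u a)
    = (penalty_sum a - dot u a) + dot u (absv (Y^T *m x)) by ring.
rewrite EFinD leeD2r// /Psi_conj /penalty_sum /dot -sumrB -sumEFin.
by apply: lee_sum => i _; rewrite mxE fenchel_conj_psi_ge.
Qed.

Lemma Ftilde_weight x a : enorm x = 1 -> (forall i, 0 <= a i 0) ->
  Ftilde phi ell Y x (map_mx g a)
    = (penalty_sum a + dot (map_mx g a) (absv (Y^T *m x) - a))%:E.
Proof.
move=> x1 a0; rewrite /Ftilde /indicator mem_set// adde0 dotBr.
have -> : penalty_sum a + (dot (map_mx g a) (absv (Y^T *m x)) - dot (map_mx g a) a)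
    = (penalty_sum a - dot (map_mx g a) a) + dot (map_mx g a) (absv (Y^T *m x)).
  by ring.
rewrite [in RHS]EFinD; congr (_ + _)%E.
rewrite /Psi_conj /penalty_sum /dot -sumrB -sumEFin.
by apply: eq_bigr => i _; rewrite !mxE fenchel_conj_psi_eq.
Qed.


(** The two second-order errors in the lower bound for the lifted function are
the curvature of the sphere, weighted by [c], and the product of the variations
of [u] and of [absv (Y^T *m x)]. *)
Lemma Ftilde_regular_subdiff x a w (c r : R) : enorm x = 1 ->
  (forall i, 0 <= a i 0) -> 0 < r ->
  (forall y, enorm y = 1 -> enorm (y - x) < r ->
     dot w y <= wabs Y (map_mx g a) y) ->
  dot w x = wabs Y (map_mx g a) x ->
  regular_subdiff (Ftilde_stacked phi ell Y) (col_mx x (map_mx g a))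
    (col_mx (w - c *: x) (absv (Y^T *m x) - a)).
Proof.
move=> x1 a0 r0 wle wE; set u := map_mx g a.
apply: (regular_subdiff_minorant (r := penalty_sum a + dot u (absv (Y^T *m x) - a))).
  by rewrite /Ftilde_stacked col_mxKu col_mxKd Ftilde_weight.
move=> e e0; have l0 := @absY_lip_ge0 R n p Y.
pose C := `|c| / 2 + absY_lip Y + 1.
have c2 : 0 <= `|c| by [].
have C0 : 0 < C by rewrite /C; lra.
exists (Num.min r (e / C)); first by rewrite lt_min r0 divr_gt0.
move=> z; rewrite lt_min ltr_pdivlMr// => /andP[zr zC].
rewrite dot_col_mx !linearB/= col_mxKu col_mxKd.
set y := usubmx z; set v := dsubmx z.
have xz : enorm (y - x) <= enorm (z - col_mx x u).
  by have := enorm_usubmx_le (z - col_mx x u); rewrite linearB/= col_mxKu.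
have uz : enorm (v - u) <= enorm (z - col_mx x u).
  by have := enorm_dsubmx_le (z - col_mx x u); rewrite linearB/= col_mxKd.
set N := enorm (z - col_mx x u) in zr zC xz uz *.
have [y1|y1] := eqVneq (enorm y) 1; last first.
  rewrite /Ftilde_stacked /Ftilde /indicator memNset; last exact/eqP.
  rewrite addey ?leey// /Psi_conj adde_eq_ninfty negb_or andbT.
  rewrite gt_eqF// (@lt_le_trans _ _ (\sum_(i < p) (phi (a i 0) - v i 0 * a i 0)%:E)%E)//.
    by rewrite sumEFin ltNyr.
  apply: lee_sum => i _; have -> : (- dsubmx z) i 0 = - v i 0 by rewrite mxE.
  exact: fenchel_conj_psi_ge.
apply: le_trans (Ftilde_ge v y1 a0); rewrite lee_fin.
have wy := wle y y1 (le_lt_trans xz zr).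
have err := normr_dot_le (v - u) (absv (Y^T *m y) - absv (Y^T *m x)).
have lipy := enorm_absY_le Y y x.
have sph := dot_sphereB x1 y1.
have -> : dot v (absv (Y^T *m y) - a)
    = dot u (absv (Y^T *m x) - a) + (wabs Y u y - wabs Y u x)
      + dot (absv (Y^T *m x) - a) (v - u)
      + dot (v - u) (absv (Y^T *m y) - absv (Y^T *m x)).
  rewrite !wabsE !(dotBr, dotBl) (dotC v (absv (Y^T *m x))) (dotC u (absv (Y^T *m x))).
  rewrite (dotC a v) (dotC a u); ring.
rewrite [dot (w - _) _]dotBl dotZl sph -wE [dot w (y - x)]dotBr.
have n1 := enorm_ge0 (y - x); have n2 := enorm_ge0 (v - u).
have e1 : c * (enorm (y - x) ^+ 2 / 2) <= `|c| / 2 * N ^+ 2.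
  have n3 : enorm (y - x) ^+ 2 <= N ^+ 2.
    by rewrite ler_pXn2r ?nnegrE// (le_trans n1).
  apply: (@le_trans _ _ (`|c| * (enorm (y - x) ^+ 2 / 2))).
    by rewrite ler_wpM2r ?ler_norm// divr_ge0 ?sqr_ge0.
  by rewrite -mulrA ler_wpM2l//; lra.
have e2 : enorm (v - u) * enorm (absv (Y^T *m y) - absv (Y^T *m x))
    <= absY_lip Y * N ^+ 2.
  rewrite expr2 mulrCA; apply: ler_pM => //; rewrite ?enorm_ge0//.
  by rewrite (le_trans lipy)// ler_wpM2l.
have e3 : C * N ^+ 2 <= e * N.
  by rewrite expr2 mulrA ler_wpM2r//; [exact: le_trans n1 xz | rewrite mulrC ltW].
have N0 : 0 <= N ^+ 2 by rewrite sqr_ge0.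
move/ler_normlP : err => [err _].
rewrite /C in e3; lra.
Qed.

(** Directional criticality of [x] for the linearisation of the objective gives
a regular subgradient [0]: concavity makes the objective lie above its
linearisation up to the variation of the weights. *)
Lemma objective_sphere_regular_subdiff x : enorm x = 1 ->
  (forall e, 0 < dot x e -> wabs Y (weight x) x * dot x e <= wabs Y (weight x) e) ->
  regular_subdiff (objective_sphere phi Y) x 0.
Proof.
move=> x1 crit.
apply: (regular_subdiff_minorant (r := objective phi Y x)).
  by rewrite /objective_sphere /indicator mem_set// adde0.
move=> e e0; have l0 := @absY_lip_ge0 R n p Y.
have e1 : 0 < e / (2 * (absY_lip Y + 1)) by rewrite divr_gt0//; lra.
have [d d0 dP] := weight_continuous x e1.
set k := wabs Y (weight x) x in crit.
have k0 : 0 <= k by apply: wabs_ge0 => i; exact: weight_ge0.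
exists (Num.min d (Num.min 1 (e / (k + 1)))).
  by rewrite !lt_min d0 ltr01 divr_gt0//; lra.
move=> y; rewrite !lt_min => /and3P[yd y2 yk].
rewrite dot0l addr0; have [y1|y1] := eqVneq (enorm y) 1; last first.
  by rewrite /objective_sphere /indicator memNset ?addey ?leey//; exact/eqP.
rewrite /objective_sphere /indicator mem_set// adde0 lee_fin.
have sph := dot_sphereB x1 y1.
have N0 := enorm_ge0 (y - x).
have xx : dot x x = 1 by rewrite -enorm_sqr x1 expr1n.
have xy : 0 < dot x y by rewrite dotBr xx in sph; nra.
have := crit _ xy; rewrite dotBr xx in sph.
have := penalty_sum_tangent (absv_ge0 (Y^T *m y)) (absv_ge0 (Y^T *m x)).
rewrite -!objectiveE -/(weight y).
rewrite -[_ - absv (Y^T *m y)]opprB dotNr.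
have -> : dot (weight y) (absv (Y^T *m y) - absv (Y^T *m x))
    = wabs Y (weight x) y - k
      + dot (weight y - weight x) (absv (Y^T *m y) - absv (Y^T *m x)).
  by rewrite /k !wabsE !(dotBl, dotBr); ring.
have := normr_dot_le (weight y - weight x) (absv (Y^T *m y) - absv (Y^T *m x)).
move=> /ler_normlP[err _] h1 h2.
have e2 : enorm (weight y - weight x) * enorm (absv (Y^T *m y) - absv (Y^T *m x))
    <= e / 2 * enorm (y - x).
  have -> : e / 2 * enorm (y - x)
      = e / (2 * (absY_lip Y + 1)) * ((absY_lip Y + 1) * enorm (y - x)).
    by field; rewrite gt_eqF//; lra.
  apply: ler_pM; rewrite ?enorm_ge0//; first by rewrite ltW// dP.
  by rewrite (le_trans (enorm_absY_le _ _ _))// ler_wpM2r//; lra.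
have e3 : k * (enorm (y - x) ^+ 2 / 2) <= e / 2 * enorm (y - x).
  rewrite ltr_pdivlMr in yk; last lra.
  nra.
have -> : objective phi Y x - e * enorm (y - x)
  = objective phi Y x - e / 2 * enorm (y - x) - e / 2 * enorm (y - x) by field.
have : k * dot x y = k - k * (enorm (y - x) ^+ 2 / 2).
  by rewrite -{2}[k]mulr1 -mulrBr; congr (_ * _); lra.
lra.
Qed.

End Lifted.

(** * Descent sequences under a Kurdyka-Lojasiewicz inequality *)

Section KLDescent.
Context {R : realType} {n : nat}.
Variables (x : nat -> 'cV[R]_n) (xs : 'cV[R]_n) (delta h : nat -> R).
Variables (hs b c : R) (a : \bar R) (vphi : R -> R) (rho : R).
Hypotheses (c0 : 0 < c) (b0 : 0 <= b) (a0 : (0 < a)%E) (rho0 : 0 < rho).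
Hypothesis delta0 : forall k, 0 <= delta k.
Hypothesis step : forall k, enorm (x k.+1 - x k) <= delta k.
Hypothesis descent : forall k, c * delta k.+1 ^+ 2 <= h k - h k.+1.
Hypothesis h_ge : forall k, hs <= h k.
Hypothesis h_lim : forall e, 0 < e -> exists N, forall k, (N <= k)%N -> h k < hs + e.
Hypothesis desing : desingularizing a vphi.
Hypothesis KL : forall k, enorm (x k - xs) < rho -> enorm (x k.+1 - xs) < rho ->
  hs < h k -> ((h k - hs)%:E < a)%E -> 1 <= derive1 vphi (h k - hs) * (b * delta k).
Hypothesis cluster_pt : forall (e : R) N, 0 < e ->
  exists2 k, (N <= k)%N & enorm (x k - xs) < e.

Let level k := vphi (h k - hs).

Let level_ge0 k : ((h k - hs)%:E < a)%E -> 0 <= level k.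
Proof. by move=> ka; case: desing => + _ _ _ _; apply; split=> //; rewrite subr_ge0. Qed.

Let h_decr k : h k.+1 <= h k.
Proof.
by have := descent k; have := mulr_ge0 (ltW c0) (sqr_ge0 (delta k.+1)); lra.
Qed.

Let gap_lt_stable k : ((h k - hs)%:E < a)%E -> ((h k.+1 - hs)%:E < a)%E.
Proof. by apply: le_lt_trans; rewrite lee_fin lerD2r. Qed.

(** Multiply the descent inequality by the KL inequality, use concavity of
[vphi] to recognise a difference of levels, and conclude by the
arithmetic-geometric mean inequality. *)
Let KL_step k : enorm (x k - xs) < rho -> enorm (x k.+1 - xs) < rho ->
  ((h k - hs)%:E < a)%E ->
  2 * delta k.+1 + b / c * level k.+1 <= delta k + b / c * level k.
Proof.
move=> xk xk1 ka; have d1 := delta0 k.+1; have d0 := delta0 k.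
have [hk|hk] := eqVneq (h k) hs.
  have hk1 : h k.+1 = hs by apply/le_anti; rewrite h_ge andbT -hk.
  have dk : delta k.+1 = 0.
    have := descent k; rewrite hk hk1 subrr pmulr_rle0// => dk.
    by apply/eqP; rewrite -sqrf_eq0 eq_le dk sqr_ge0.
  by rewrite dk mulr0 add0r /level hk hk1 lerDr.
have {}hk : hs < h k by rewrite lt_neqAle eq_sym hk h_ge.
have gap : 0 < h k - hs by rewrite subr_gt0.
case: desing => _ _ conc _ /(_ _ gap ka)[dv _].
set q : R := derive1 vphi (h k - hs) => q0.
have kl : 1 <= q * (b * delta k) := KL xk xk1 hk ka.
have : level k.+1 <= level k + q * ((h k.+1 - hs) - (h k - hs)).
  apply: (concave_tangent conc) => //=; first by split=> //; exact: ltW.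
  by split; [rewrite subr_ge0 h_ge | exact: gap_lt_stable].
set u := level k.+1; set v := level k => uv.
have cq : q * (c * delta k.+1 ^+ 2) <= v - u.
  by have := descent k; nra.
have vu : 0 <= v - u.
  by apply: le_trans cq; rewrite mulr_ge0 ?(ltW q0)// mulr_ge0 ?sqr_ge0// ltW.
have bd : 0 <= b * delta k by rewrite mulr_ge0.
have sq : delta k.+1 ^+ 2 <= delta k * (b / c * (v - u)).
  have -> : delta k * (b / c * (v - u)) = (b * delta k * (v - u)) / c by ring.
  rewrite ler_pdivlMr// mulrC.
  apply: le_trans (_ : (b * delta k) * (q * (c * delta k.+1 ^+ 2)) <= _); last first.
    by rewrite ler_wpM2l.
  have -> : b * delta k * (q * (c * delta k.+1 ^+ 2))
    = (q * (b * delta k)) * (c * delta k.+1 ^+ 2) by ring.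
  by rewrite ler_peMl// mulr_ge0 ?sqr_ge0// ltW.
have B0 : 0 <= b / c * (v - u) by rewrite mulr_ge0// divr_ge0// ltW.
suff : 2 * delta k.+1 <= delta k + b / c * (v - u) by lra.
have r0 := addr_ge0 d0 B0; have l0 := mulr_ge0 (ler0n R 2) d1.
rewrite -(@ler_pXn2r _ 2) ?nnegrE//.
have := sqr_ge0 (delta k - b / c * (v - u)).
move: sq; set z := b / c * (v - u); nra.
Qed.

Let level_small e : 0 < e -> exists2 d, 0 < d &
  forall k, h k < hs + d -> ((h k - hs)%:E < a)%E /\ level k < e.
Proof.
move=> e0; case: desing => _ cont _ v0 _.
have : vphi s @[s --> within [set s : R | 0 <= s /\ (s%:E < a)%E] (nbhs (0 : R))] --> 0.
  rewrite -[X in _ --> X]v0.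
  by move/subspace_continuousP : cont => /(_ 0 (conj (lexx 0) a0)).
move=> /cvgrPdist_lt /(_ _ e0) /nbhs_ballP[d /= d0 dP].
have [r r0 ra] : exists2 r : R, 0 < r & (r%:E <= a)%E.
  by case: a a0 => [r|_|//]; [rewrite lte_fin; exists r | exists 1; rewrite ?leey].
exists (Num.min d r); first by rewrite lt_min d0 r0.
move=> k; rewrite -ltrBlDl lt_min => /andP[kd kr].
have ka : ((h k - hs)%:E < a)%E by apply: lt_le_trans ra; rewrite lte_fin.
have gap : 0 <= h k - hs by rewrite subr_ge0 h_ge.
split=> //; have := dP (h k - hs).
rewrite -ball_normE /ball_/= !sub0r !normrN (ger0_norm gap) => /(_ kd (conj gap ka)).
exact/le_lt_trans/ler_norm.
Qed.

Let delta_small e : 0 < e -> exists N, forall k, (N <= k)%N -> delta k < e.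
Proof.
move=> e0; have [|N NP] := h_lim (_ : 0 < c * e ^+ 2); first by rewrite mulr_gt0 ?exprn_gt0.
exists N.+1 => -[//|k] /NP hk; rewrite -(@ltr_pXn2r _ 2) ?nnegrE ?(ltW e0)//.
rewrite -(ltr_pM2l c0) (le_lt_trans (descent k))//.
by have := h_ge k.+1; lra.
Qed.

(** Once [x K] is close to [xs], the potential made of the length travelled since
[K], twice the current step and the rescaled level never increases, so the
iterates cannot leave a small ball around [xs]. *)
Let trap K e : e <= rho -> ((h K - hs)%:E < a)%E ->
  enorm (x K - xs) + (2 * delta K + b / c * level K) < e ->
  forall m, enorm (x (K + m)%N - xs) < e.
Proof.
move=> erho Ka; set M := 2 * delta K + _ => KM.
have bc0 : 0 <= b / c by rewrite divr_ge0// ltW.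
pose S m := \sum_(j < m) delta (K + j)%N.
have path m : enorm (x (K + m)%N - xs) <= enorm (x K - xs) + S m.
  elim: m => [|m IH]; first by rewrite addn0 /S big_ord0 addr0.
  rewrite -(subrKA (x (K + m)%N)) addrC addnS (le_trans (ler_enormD _ _))//.
  rewrite /S big_ord_recr/= addrA -/(S m); have := step (K + m); lra.
suff inv m : [/\ ((h (K + m)%N - hs)%:E < a)%E, enorm (x (K + m)%N - xs) < e
    & S m + (2 * delta (K + m)%N + b / c * level (K + m)%N) <= M].
  by move=> m; case: (inv m).
elim: m => [|m [ka xm pot]].
  rewrite addn0 /S big_ord0 add0r; split=> //.
  have := mulr_ge0 bc0 (level_ge0 Ka); have := delta0 K; rewrite /M in KM; lra.
have lm := mulr_ge0 bc0 (level_ge0 ka).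
have dm := delta0 (K + m).
have SS : S m.+1 = S m + delta (K + m)%N by rewrite /S big_ord_recr.
have xm1 : enorm (x (K + m.+1)%N - xs) < e.
  by have := path m.+1; rewrite SS; lra.
rewrite addnS in xm1 *; split=> //; first exact: gap_lt_stable.
have := KL_step (lt_le_trans xm erho) (lt_le_trans xm1 erho) ka.
by rewrite SS; lra.
Qed.

Lemma KL_descent_cvg : x @ \oo --> xs.
Proof.
apply/cvg_ballP => e0 e00.
have /nbhs_enormP[e1 e10 e1P] : nbhs xs (ball xs e0) by exact: nbhsx_ballx.
pose e := Num.min e1 rho.
have e_gt0 : 0 < e by rewrite lt_min e10 rho0.
have bc1 : 0 < b / c + 1 by rewrite ltr_wpDl// divr_ge0// ltW.
have ee : 0 < e / (4 * (b / c + 1)) by rewrite divr_gt0// mulr_gt0.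
have [d d0 dP] := level_small ee.
have [N1 N1P] := h_lim d0.
have [N2 N2P] := delta_small (divr_gt0 e_gt0 (ltr0Sn R 7)).
have [K NK xK] := cluster_pt (maxn N1 N2) (divr_gt0 e_gt0 (ltr0Sn R 3)).
move: NK; rewrite geq_max => /andP[/N1P/dP[Ka lK] /N2P dK].
exists K => // m /= Km; apply: e1P; apply: lt_le_trans (_ : e <= _).
  rewrite -(subnKC Km); apply: trap => //; first by rewrite ge_min lexx orbT.
  have : (b / c + 1) * level K <= e / 4.
    have -> : e / 4 = (b / c + 1) * (e / (4 * (b / c + 1))).
      by move: (b / c + 1) bc1 => q q0; field; rewrite gt_eqF.
    by rewrite ler_wpM2l ?ltW.
  have := level_ge0 Ka; lra.
by rewrite ge_min lexx.
Qed.

End KLDescent.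

(** * Iterates of the reweighted proximal point method *)

Section Iterates.
Context {R : realType} {n p : nat}.
Variables (Y : 'M[R]_(n, p)) (phi g : R -> R) (ell t : R).
Hypotheses (sg : supergradient phi g ell) (phi0 : phi 0 = 0) (t0 : 0 < t).
Implicit Types (x d e : 'cV[R]_n).

Local Notation weight := (weights g Y).
Local Notation minimizer x d :=
  (minimizer_on [set e | dot x e = 0] (subproblem Y t x (weight x)) d).
Definition next x d : 'cV[R]_n := (enorm (x + d))^-1 *: (x + d).

Let ell_ge0 : 0 <= ell.
Proof. exact: le_trans (supergradient_ge0 sg (lexx 0)) (supergradient_le sg (lexx 0)). Qed.

(** The value of the lifted function at the stacked point [(e, weight x)]. *)
Definition lifted_value x e : R := objective phi Y x
  + dot (weight x) (absv (Y^T *m e) - absv (Y^T *m x)).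

Lemma Ftilde_lifted_value x e : enorm e = 1 ->
  Ftilde_stacked phi ell Y (col_mx e (weight x)) = (lifted_value x e)%:E.
Proof.
move=> e1; rewrite /Ftilde_stacked col_mxKu col_mxKd.
rewrite (Ftilde_weight Y sg phi0 e1 (absv_ge0 _)).
by rewrite /lifted_value objectiveE.
Qed.

Lemma objective_le_lifted_value x e : objective phi Y e <= lifted_value x e.
Proof.
by rewrite /lifted_value !objectiveE; apply: (penalty_sum_tangent sg) => i; exact: absv_ge0.
Qed.

Section Step.
Variables x d : 'cV[R]_n.
Hypotheses (x1 : enorm x = 1) (dmin : minimizer x d).

Let weight0 := weight_ge0 Y sg x.
Let xd : dot x d = 0 := dmin.1.
Let r1 : 1 <= enorm (x + d) := (enorm_retraction x1 xd).1.
Let r0 : 0 < enorm (x + d).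
Proof. exact: lt_le_trans ltr01 r1. Qed.

Lemma enorm_next : enorm (next x d) = 1.
Proof. by rewrite enormZ ger0_norm ?invr_ge0 ?ltW// mulVf ?gt_eqF. Qed.

Lemma next_step_le : enorm (next x d - x) <= enorm d.
Proof. exact: (enorm_retraction x1 xd).2. Qed.

(** Since [x + d] has length at least [1], scaling it back to the sphere can only
decrease the positively homogeneous model. *)
Lemma lifted_value_next_le :
  lifted_value x (next x d) <= objective phi Y x - t^-1 * enorm d ^+ 2.
Proof.
have := prox_mult_le t0 x1 weight0 dmin; rewrite /prox_mult => h.
rewrite /lifted_value lerD2l dotBr -!wabsE wabsZ ger0_norm ?invr_ge0 ?(ltW r0)//.
have : (enorm (x + d))^-1 * wabs Y (weight x) (x + d) <= wabs Y (weight x) (x + d).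
  by rewrite ler_piMl ?wabs_ge0// invf_le1.
by lra.
Qed.

Definition subgrad_const : R := p%:R * ell * absY_lip Y + t^-1 + absY_lip Y.

(** A subgradient at the new lifted point: the [x] part comes from the optimality
of [d], with the multiplier attached to the new base point, and the weight part
is the variation of [absv (Y^T *m x)]. Both are controlled by the step. *)
Lemma lifted_subgrad_le : exists2 v,
  limiting_subdiff (Ftilde_stacked phi ell Y) (col_mx (next x d) (weight x)) v &
  enorm v <= subgrad_const * enorm d.
Proof.
have wP := prox_subgradP t0 x1 weight0 dmin.
have wE := prox_subgradE x1 dmin.
set w := prox_subgrad Y t x d (weight x) in wP wE; set k := prox_mult Y t x d (weight x).
have rV0 : 0 < (enorm (x + d))^-1 by rewrite invr_gt0.
exists (col_mx (w - k *: next x d) (absv (Y^T *m next x d) - absv (Y^T *m x))).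
  apply: regular_limiting_subdiff.
  apply: (Ftilde_regular_subdiff sg phi0 k enorm_next (absv_ge0 _) rV0).
    move=> y y1 yr; apply: wP.
    have : dot x (next x d) = (enorm (x + d))^-1.
      by rewrite /next dotZr dotDr xd addr0 -enorm_sqr x1 expr1n mulr1.
    have := normr_dot_le x (y - next x d); rewrite x1 mul1r => /ler_normlP[h _].
    by move: h; rewrite dotBr; lra.
  by rewrite /next dotZr wE wabsZ ger0_norm ?ltW.
have d0 := enorm_ge0 d; have l0 := @absY_lip_ge0 R n p Y.
have k0 : 0 <= k by exact: prox_mult_ge0.
have kle : k <= p%:R * ell * absY_lip Y.
  apply: le_trans (prox_mult_le t0 x1 weight0 dmin) _.
  rewrite wabsE (le_trans (dot_le_enorm _ _))// ler_pM ?enorm_ge0//.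
    exact: (enorm_weight_le Y sg).
  by have := enorm_absY_le0 Y x; rewrite x1 mulr1.
have -> : w - k *: next x d = k *: (x - next x d) - t^-1 *: d.
  by rewrite /w /prox_subgrad -/k scalerBr addrAC.
have := enorm_col_mx_le (k *: (x - next x d) - t^-1 *: d)
  (absv (Y^T *m next x d) - absv (Y^T *m x)).
have := ler_enormD (k *: (x - next x d)) (- (t^-1 *: d)).
rewrite enormN !enormZ (ger0_norm k0) ger0_norm ?invr_ge0 ?(ltW t0)// enormBC.
have := enorm_absY_le Y (next x d) x; have := next_step_le.
have : k * enorm (next x d - x) <= p%:R * ell * absY_lip Y * enorm d.
  by rewrite ler_pM ?enorm_ge0 ?next_step_le.
have : absY_lip Y * enorm (next x d - x) <= absY_lip Y * enorm d.
  by rewrite ler_wpM2l ?next_step_le.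
rewrite /subgrad_const 2!mulrDl; lra.
Qed.

End Step.

(** Points where the linearised objective does not decrease along the tangent
directions, written without projecting onto the tangent hyperplane. *)
Definition critical x := forall e, 0 < dot x e ->
  wabs Y (weight x) x * dot x e <= wabs Y (weight x) e.

(** This is the previous construction with [d = 0], and it produces the
subgradient [0]. *)
Lemma critical_subdiff x : enorm x = 1 -> critical x ->
  dom_subdiff (Ftilde_stacked phi ell Y) (col_mx x (weight x)).
Proof.
move=> x1 crit; exists (col_mx (wabs Y (weight x) x *: x - wabs Y (weight x) x *: x)
  (absv (Y^T *m x) - absv (Y^T *m x))).
apply: regular_limiting_subdiff.
have xx : dot x x = 1 by rewrite -enorm_sqr x1 expr1n.
apply: (Ftilde_regular_subdiff sg phi0 _ x1 (absv_ge0 _) ltr01).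
  move=> y y1 yx; rewrite dotZl; apply: crit.
  have := normr_dot_le x (y - x); rewrite x1 mul1r dotBr xx => /ler_normlP[h _].
  lra.
by rewrite dotZl xx mulr1.
Qed.

(** Optimality of the steps passes to the limit because the weights depend
continuously on the base point and the steps vanish. *)
Lemma critical_limit (x d : nat -> 'cV[R]_n) xs :
  enorm xs = 1 -> (forall k, enorm (x k) = 1) ->
  (forall k, minimizer (x k) (d k)) ->
  (forall m, 0 < m -> exists k, enorm (x k - xs) < m /\ enorm (d k) < m) ->
  critical xs.
Proof.
move=> xs1 x1 dmin lim e xe; apply/ler_addgt0Pr => eps eps0.
have l0 := @absY_lip_ge0 R n p Y.
set lip := absY_lip Y in l0; set L := p%:R * ell; set E := enorm e.
set k0 := wabs Y (weight xs) xs.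
have E0 : 0 <= E by exact: enorm_ge0.
have L0 : 0 <= L by rewrite mulr_ge0.
have tV0 : 0 <= t^-1 by rewrite invr_ge0 ltW.
have k00 : 0 <= k0 by apply: wabs_ge0 => i; exact: (weight_ge0 Y sg).
pose K1 := 2 * (L * lip) + lip.
pose K := lip * E + k0 * E + K1 * E + t^-1 * E.
have K10 : 0 <= K1 by rewrite addr_ge0// mulr_ge0// mulr_ge0.
have K0 : 0 <= K by rewrite !addr_ge0// mulr_ge0.
have K_gt0 : 0 < K + 1 by lra.
have E_gt0 : 0 < E + 1 by lra.
pose m := Num.min (eps / (K + 1)) (dot xs e / (E + 1)).
have m0 : 0 < m by rewrite lt_min !divr_gt0.
have [r r0 rP] := weight_continuous Y sg xs m0.
have [|k []] := lim (Num.min m r); first by rewrite lt_min m0.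
rewrite lt_min => /andP[xm /rP um]; rewrite lt_min => /andP[dm _].
have mK : m * (K + 1) <= eps by rewrite -ler_pdivlMr// ge_min lexx.
have mE : m * (E + 1) <= dot xs e by rewrite -ler_pdivlMr// ge_min lexx orbT.
have u0 := weight_ge0 Y sg (x k).
have uL := enorm_weight_le Y sg (x k).
set u := weight (x k) in um u0 uL.
have h1 : wabs Y u e <= wabs Y (weight xs) e + m * (lip * E).
  have /ler_normlP[_ h] := wabs_lipl Y u (weight xs) e.
  have : enorm (u - weight xs) * (lip * E) <= m * (lip * E).
    by rewrite ler_wpM2r ?mulr_ge0// ltW.
  by move: h; rewrite -/lip -/E; lra.
have h2 : wabs Y u (x k) - L * (lip * m) <= wabs Y u (x k + d k).
  have /ler_normlP[h _] := wabs_lipr Y u (x k + d k) (x k).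
  have : enorm u * (lip * enorm (d k)) <= L * (lip * m).
    apply: ler_pM; rewrite ?enorm_ge0 ?mulr_ge0 ?enorm_ge0//.
    by rewrite ler_wpM2l// ltW.
  by move: h; rewrite addrAC subrr add0r -/lip; lra.
have h3 : wabs Y u xs - L * (lip * m) <= wabs Y u (x k).
  have /ler_normlP[h _] := wabs_lipr Y u (x k) xs.
  have : enorm u * (lip * enorm (x k - xs)) <= L * (lip * m).
    apply: ler_pM; rewrite ?enorm_ge0 ?mulr_ge0 ?enorm_ge0//.
    by rewrite ler_wpM2l// ltW.
  by move: h; rewrite -/lip; lra.
have h4 : k0 - m * lip <= wabs Y u xs.
  have /ler_normlP[h _] := wabs_lipl Y u (weight xs) xs.
  have : enorm (u - weight xs) * lip <= m * lip by rewrite ler_wpM2r// ltW.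
  by move: h; rewrite xs1 mulr1 -/lip -/k0; lra.
have kk : k0 - m * K1 <= prox_mult Y t (x k) (d k) u.
  have : 0 <= t^-1 * enorm (d k) ^+ 2 by rewrite mulr_ge0 ?sqr_ge0.
  by rewrite /prox_mult /K1; lra.
have /ler_normlP[h5 _] := normr_dot_le (x k - xs) e.
have h6 : enorm (x k - xs) * E <= m * E by rewrite ler_wpM2r// ltW.
rewrite dotBl -/E in h5.
have xke : 0 < dot (x k) e by lra.
have xkE : dot (x k) e <= E.
  by have := dot_le_enorm (x k) e; rewrite x1 mul1r.
have /ler_normlP[_ h7] := normr_dot_le (d k) e.
have h8 : t^-1 * dot (d k) e <= t^-1 * (m * E).
  rewrite ler_wpM2l// (le_trans h7)// ler_wpM2r// ltW//.
have := prox_subgradP t0 (x1 k) u0 (dmin k) xke.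
rewrite /prox_subgrad dotBl !dotZl.
have h9 : (k0 - m * K1) * dot (x k) e <= prox_mult Y t (x k) (d k) u * dot (x k) e.
  by rewrite ler_wpM2r// ltW.
have h10 : m * K1 * dot (x k) e <= m * K1 * E.
  by rewrite ler_wpM2l// mulr_ge0// ltW.
have h11 : k0 * dot xs e <= k0 * (dot (x k) e + m * E).
  by rewrite ler_wpM2l//; lra.
move: mK; rewrite /K; move: h1 h8 h9 h10 h11.
rewrite -/k0; nra.
Qed.

End Iterates.

Theorem theorem3p8 (R : realType) (n p : nat) (Y : 'M[R]_(n, p))
    (phi : R -> R) (ell : R)
    (phi_ge0 : forall s, 0 <= s -> 0 <= phi s)
    (phi_cont : {within [set s : R | 0 <= s], continuous phi})
    (phi_concave : concave_on [set s : R | 0 <= s] phi)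
    (phi0 : phi 0 = 0)
    (phi_diff : forall s, 0 < s -> derivable phi s 1)
    (phi_ell : derive1 phi s @[s --> 0^'+] --> ell)
    (hKL : KL_function (Ftilde_stacked phi ell Y))
    (t : R) (x : nat -> 'cV[R]_n)
    (hx : manppa_rw_sequence phi ell Y t x) :
  exists xstar : 'cV[R]_n, x @ \oo --> xstar /\ stationary_point phi Y xstar.
Proof.
have sg := right_deriv_supergradient phi_ge0 phi_cont phi_concave phi0 phi_diff phi_ell.
set g := right_deriv phi in sg.
case: hx => x01 t0 _ /choice[d dP].
have dmin k : minimizer_on [set e | dot (x k) e = 0]
    (subproblem Y t (x k) (weights g Y (x k))) (d k) by case: (dP k).
have xS k : x k.+1 = next (x k) (d k) by case: (dP k).
have x1 k : enorm (x k) = 1.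
  elim: k => [//|k IH]; rewrite xS; exact: (enorm_next IH (dmin k)).
have tV0 : 0 < t^-1 by rewrite invr_gt0.
pose h k := lifted_value Y phi g (x k) (x k.+1).
have fle k : objective phi Y (x k.+1) <= h k := objective_le_lifted_value Y sg _ _.
have hle k : h k <= objective phi Y (x k) - t^-1 * enorm (d k) ^+ 2.
  by rewrite /h xS; exact: (lifted_value_next_le sg t0 (x1 k) (dmin k)).
have f_decr k : objective phi Y (x k.+1) <= objective phi Y (x k).
  have := mulr_ge0 (ltW tV0) (sqr_ge0 (enorm (d k))).
  by have := fle k; have := hle k; lra.
have f_mono j k : (j <= k)%N -> objective phi Y (x k) <= objective phi Y (x j).
  move=> /subnKC <-; elim: (k - j)%N => [|m]; first by rewrite addn0.
  by rewrite addnS; exact: le_trans.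
have [xs xs1 clus] := sphere_cluster x1.
pose fs := objective phi Y xs.
pose L := p%:R * ell * absY_lip Y.
have L0 : 0 <= L.
  rewrite mulr_ge0 ?absY_lip_ge0// mulr_ge0//.
  exact: le_trans (supergradient_ge0 sg (lexx 0)) (supergradient_le sg (lexx 0)).
have L1 : 0 < L + 1 by lra.
(* the objective is Lipschitz, so its values decrease to the value at [xs] *)
have f_near (e : R) : 0 < e -> exists2 r, 0 < r & forall k, enorm (x k - xs) < r ->
    objective phi Y (x k) < fs + e /\ fs < objective phi Y (x k) + e.
  move=> e0; exists (e / (L + 1)); first by rewrite divr_gt0.
  move=> k; rewrite ltr_pdivlMr// => xk.
  have := objective_lip Y sg (x k) xs; have := objective_lip Y sg xs (x k).
  rewrite (enormBC xs) !mulrA -/L -/fs; have := enorm_ge0 (x k - xs).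
  by split; lra.
have f_ge k : fs <= objective phi Y (x k).
  apply/ler_addgt0Pr => e e0; have [r r0 rP] := f_near e e0.
  have [j kj /rP[_ xj]] := clus r k r0.
  by have := f_mono k j kj; lra.
have f_lim (e : R) : 0 < e -> exists N, forall k, (N <= k)%N ->
    objective phi Y (x k) < fs + e.
  move=> e0; have [r r0 rP] := f_near e e0; have [N _ /rP[xN _]] := clus r 0%N r0.
  by exists N => k Nk; exact: le_lt_trans (f_mono _ _ Nk) xN.
have h_ge k : fs <= h k := le_trans (f_ge k.+1) (fle k).
have h_lef k : h k <= objective phi Y (x k).
  have := mulr_ge0 (ltW tV0) (sqr_ge0 (enorm (d k))).
  by have := hle k; lra.
have h_lim (e : R) : 0 < e -> exists N, forall k, (N <= k)%N -> h k < fs + e.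
  move=> /f_lim[N NP]; exists N => k /NP; exact: le_lt_trans.
have crit : critical Y g xs.
  apply: (critical_limit sg t0 xs1 x1 dmin) => m m0.
  have m2 : 0 < t^-1 * m ^+ 2 by rewrite mulr_gt0// exprn_gt0.
  have [N NP] := f_lim _ m2.
  have [k /NP fk xk] := clus m N m0; exists k; split=> //.
  rewrite -(@ltr_pXn2r _ 2) ?nnegrE ?enorm_ge0 ?(ltW m0)// -(ltr_pM2l tV0).
  by have := hle k; have := h_ge k; lra.
have stat : stationary_point phi Y xs.
  by apply: regular_limiting_subdiff; exact: (objective_sphere_regular_subdiff sg xs1).
exists xs; split=> //.
have [a [V [vphi [a0 Vnbhs desing KL]]]] := hKL _ (critical_subdiff sg phi0 xs1 crit).
have [r /= r0 rV] := (nbhs_enormP _ _).1 Vnbhs.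
have r2 : 0 < r / 2 by lra.
have [s s0 sP] := weight_continuous Y sg xs r2.
have Fs : Ftilde_stacked phi ell Y (col_mx xs (weights g Y xs)) = fs%:E.
  rewrite (Ftilde_lifted_value Y sg phi0 _ xs1) /lifted_value.
  by rewrite subrr dotC dot0l addr0.
pose b := subgrad_const Y ell t.
have b0 : 0 <= b.
  by rewrite addr_ge0 ?absY_lip_ge0// addr_ge0// ltW.
have rho0 : 0 < Num.min s (r / 2) by rewrite lt_min s0.
apply: (KL_descent_cvg (delta := fun k => enorm (d k)) tV0 b0 a0 rho0
  _ _ _ h_ge h_lim desing _ clus) => [k|k|k|k]; first exact: enorm_ge0.
- by rewrite xS; exact: (next_step_le (x1 k) (dmin k)).
- by have := hle k.+1; have := fle k; rewrite -/(h k); lra.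
rewrite !lt_min => /andP[/sP uk _] /andP[_ xk] hk ka.
have FE : Ftilde_stacked phi ell Y (col_mx (x k.+1) (weights g Y (x k))) = (h k)%:E.
  exact: Ftilde_lifted_value.
have := KL (col_mx (x k.+1) (weights g Y (x k))).
rewrite FE Fs -EFinB/= lte_fin.
have Vk : V (col_mx (x k.+1) (weights g Y (x k))).
  apply: rV; rewrite opp_col_mx add_col_mx (le_lt_trans (enorm_col_mx_le _ _))//.
  by rewrite [r]splitr ltrD.
have kaa : ((h k)%:E < fs%:E + a)%E by rewrite addeC -lteBlDr.
move=> /(_ Vk hk kaa).
have gap : 0 < h k - fs by rewrite subr_gt0.
have dv : 0 < derive1 vphi (h k - fs) by case: desing => _ _ _ _ /(_ _ gap ka)[].
have [v vsub vle] := lifted_subgrad_le sg phi0 t0 (x1 k) (dmin k).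
move=> KLk; rewrite -lee_fin EFinM; apply: le_trans KLk _.
apply: lee_wpmul2l; first by rewrite lee_fin ltW.
apply: (@le_trans _ _ (enorm v)%:E); last by rewrite lee_fin.
by apply: ereal_inf_lbound; exists v => //; rewrite xS.
Qed.
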